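(* Let $n,m\ge 1$, let $(\{v_j\},\{p_j\})$ be a sequential norming pair for $\mathbb{R}^n$ such that $$p_j\left\lfloor\frac{\|v_{j+1}\|}{\|v_j\|}-1\right\rfloor\ge 1\quad\text{for all but finitely many } j,$$ let $\{q_j\}$ be any sequence in $\mathbb{R}^m$, and let $w_j=(v_j,q_j)\in\mathbb{R}^{n+m}$, so that $(\{w_j\},\{p_j\})$ is an extended norming pair for $\mathbb{R}^{n+m}$. Let $(G_w,\sigma_w)$ be the topological group generated by $(\{w_j\},\{p_j\})$. Then the completion $\mathcal{C}(G_w,\sigma_w)$ is one dimensional, locally totally disconnected, and not locally compact.
   Context: All sequences are indexed by $\mathbb{N}=\{1,2,\dots\}$, and $\lfloor x\rfloor$ is the greatest integer less than or equal to $x$. A sequential norming pair (SNP) for $\mathbb{R}^n$ is a pair $(\{v_j\},\{p_j\})$ where $\{p_j\}$ is a nonincreasing sequence of positive real numbers converging to $0$, and $\{v_j\}$ is a sequence in $\mathbb{R}^n\setminus\{0\}$ such that $\{\|v_j\|\}$ (Euclidean norm) is nondecreasing and $\{p_{j+1}\|v_{j+1}\|/\|v_j\|\}$ has a positive lower bound. If $(\{v_j\},\{p_j\})$ is an SNP for $\mathbb{R}^n$ and $\{q_j\}$ is a sequence in $\mathbb{R}^m$, then $(\{(v_j,q_j)\},\{p_j\})$ is called an extended norming pair (ENP) for $\mathbb{R}^{n+m}$. The topological group generated by an SNP or ENP $(\{w_j\},\{p_j\})$ is $(G_w,\sigma_w)$, where $G_w$ is the subgroup of the ambient Euclidean space generated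 by $\{w_j\}$ and $\sigma_w(x)=\inf\{\sum |c_j|p_j : x=\sum c_jw_j,\ c_j\in\mathbb{Z}\}$ (finite sums). $\sigma_w$ induces the translation-invariant metric $d(x,y)=\sigma_w(x-y)$ and a metrizable group topology on $G_w$ (known). $\mathcal{C}(G_w,\sigma_w)$ is the completion of $G_w$ as a metric space for $d$, with the group operations extended continuously. These groups are separable metrizable, so all standard dimension functions (small inductive, large inductive, covering) agree; ''dimension'' means any of them. A space is totally disconnected if its components are points; a topological group is locally totally disconnected if the identity has a totally disconnected neighborhood. *)

(* Defs.v *)
From HB Require Import structures.
From mathcomp Require Import all_boot all_order all_algebra generic_quotient.
From mathcomp Require Import all_classical all_reals all_analysis.
From mathcomp Require Import ring lra.

Set Implicit Arguments.
Unset Strict Implicit.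
Unset Printing Implicit Defensive.

Import Order.TTheory GRing.Theory Num.Theory.
Import numFieldNormedType.Exports numFieldTopology.Exports.
Import metricType_numDomainType.

Local Open Scope classical_set_scope.
Local Open Scope ring_scope.
Local Open Scope quotient_scope.

Definition boundary (T : topologicalType) (A : set T) : set T :=
  closure A `\` interior A.

(* [ind_lt d T] is "ind T < d", i.e. "ind T <= d - 1", for the small inductive
   dimension, with ind T = -1 iff T is empty. [set_type] carries the relative
   topology. (The library's [zero_dimensional] is a different notion: it says
   that points are separated by clopen sets.) *)
Fixpoint ind_lt (d : nat) (T : topologicalType) : Prop :=
  match d with
  | 0 => ~ (exists x : T, True)
  | d'.+1 => forall (x : T) (U : set T), nbhs x U ->
      exists V : set T,
        [/\ open V, V x, V `<=` U & ind_lt d' (set_type (boundary V))]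
  end.

Definition has_dimension (T : topologicalType) (d : nat) : Prop :=
  ind_lt d.+1 T /\ ~ ind_lt d T.

Definition locally_totally_disconnected (G : topologicalZmodType) : Prop :=
  exists2 U : set G, nbhs 0 U & totally_disconnected U.

Section cauchy_sequences.
Context {R : realType} (T : metricType R).

Definition cauchy_seq := {u : nat -> T | `[< cauchy (u @ \oo) >]}.

HB.instance Definition _ := Choice.on cauchy_seq.

Lemma cauchy_seqP (u : nat -> T) :
  cauchy (u @ \oo) <-> forall e : R, 0 < e ->
  exists N, forall i j, (N <= i)%N -> (N <= j)%N -> mdist (u i) (u j) < e.
Proof.
split=> [/cauchy_ballP cu e e0|h].
  have := cu _ e0; rewrite near_simpl => -[[A B] /= [[N1 _ A1] [N2 _ B2]] AB].
  exists (maxn N1 N2) => i j; rewrite !geq_max => /andP[i1 i2] /andP[j1 j2].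
  have := AB (i, j) (conj (A1 _ i1) (B2 _ j2)).
  by rewrite /= ballEmdist.
apply/cauchy_ballP => e e0; have [N hN] := h e e0.
rewrite near_simpl; exists ([set i | (N <= i)%N], [set i | (N <= i)%N]).
  by split=> /=; exists N.
by move=> [i j] /= [Ni Nj]; rewrite ballEmdist; exact: hN.
Qed.

Lemma cauchy_seq_near (u : cauchy_seq) (e : R) : 0 < e ->
  exists N, forall i j, (N <= i)%N -> (N <= j)%N ->
    mdist (val u i) (val u j) < e.
Proof. by move=> e0; case: u => u /= /asboolP/cauchy_seqP; exact. Qed.

Lemma mdist_lip (x y x' y' : T) :
  `|mdist x y - mdist x' y'| <= mdist x x' + mdist y y'.
Proof.
rewrite ler_norml; apply/andP; split.
- rewrite lerNl opprB lerBlDr.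
  rewrite (le_trans (metric_triangle _ x _))// (metric_sym x').
  by rewrite -addrA lerD2l addrC metric_triangle.
- rewrite lerBlDr (le_trans (metric_triangle _ x' _))// -addrA lerD2l addrC.
  by rewrite (le_trans (metric_triangle _ y' _))// (metric_sym y').
Qed.

Lemma cauchy_seq_cvg (u v : cauchy_seq) :
  cvgn (fun n => mdist (val u n) (val v n) : R).
Proof.
apply/cauchy_cvgP/cauchy_ballP => e e0.
have e20 : 0 < e / 2 by rewrite divr_gt0.
have [N1 h1] := cauchy_seq_near u e20; have [N2 h2] := cauchy_seq_near v e20.
pose f n : R := mdist (val u n) (val v n).
rewrite near_simpl.
pose A := [set i | (maxn N1 N2 <= i)%N]; exists (A, A).
  by split=> /=; exists (maxn N1 N2).
move=> [i j] [] /=; rewrite /A /= !geq_max => /andP[i1 i2] /andP[j1 j2].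
rewrite -ball_normE /= (le_lt_trans (mdist_lip _ _ _ _))//.
by rewrite [ltRHS](splitr e) ltrD ?h1 ?h2.
Qed.

Definition cauchy_dist (u v : cauchy_seq) : R :=
  limn (fun n => mdist (val u n) (val v n)).

Lemma cauchy_dist_ge0 u v : 0 <= cauchy_dist u v.
Proof.
apply: limr_ge; first exact: cauchy_seq_cvg.
by apply: nearW => n; exact: mdist_ge0.
Qed.

Lemma cauchy_distxx u : cauchy_dist u u = 0.
Proof.
rewrite /cauchy_dist (_ : (fun n => _) = fun=> 0) ?lim_cst//.
by apply/funext => n; rewrite mdistxx.
Qed.

Lemma cauchy_distC u v : cauchy_dist u v = cauchy_dist v u.
Proof. by congr (limn _); apply/funext => n; rewrite metric_sym. Qed.

Lemma cauchy_dist_triangle v u w :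
  cauchy_dist u w <= cauchy_dist u v + cauchy_dist v w.
Proof.
rewrite /cauchy_dist -limD; [|exact: cauchy_seq_cvg..].
apply: ler_lim; [exact: cauchy_seq_cvg| |].
  by apply: is_cvgD; exact: cauchy_seq_cvg.
by apply: nearW => n /=; exact: metric_triangle.
Qed.

Definition cauchy_equiv (u v : cauchy_seq) : bool := cauchy_dist u v == 0.

Lemma cauchy_equiv_refl : reflexive cauchy_equiv.
Proof. by move=> u; rewrite /cauchy_equiv cauchy_distxx. Qed.

Lemma cauchy_equiv_sym : symmetric cauchy_equiv.
Proof. by move=> u v; rewrite /cauchy_equiv cauchy_distC. Qed.

Lemma cauchy_equiv_trans : transitive cauchy_equiv.
Proof.
move=> v u w /eqP uv /eqP vw; rewrite /cauchy_equiv eq_le cauchy_dist_ge0 andbT.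
by rewrite (le_trans (cauchy_dist_triangle v _ _))// uv vw addr0.
Qed.

Canonical cauchy_equiv_rel := EquivRel cauchy_equiv
  cauchy_equiv_refl cauchy_equiv_sym cauchy_equiv_trans.

(* Cauchy sequences modulo d(u_n, v_n) --> 0; see [to_completion_isometry],
   [to_completion_dense], [completion_complete] and [to_completionB]. *)
Definition completion := {eq_quot cauchy_equiv}.

HB.instance Definition _ := Choice.on completion.
HB.instance Definition _ := EqQuotient.on completion.

Definition completion_dist (x y : completion) : R :=
  cauchy_dist (repr x) (repr y).

Lemma completion_distE (u v : cauchy_seq) :
  completion_dist (\pi_completion u) (\pi_completion v) = cauchy_dist u v.
Proof.
have h w : cauchy_dist (repr (\pi_completion w)) w = 0.
  by apply/eqP; rewrite -/(cauchy_equiv _ _) -eqmodE reprK.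
rewrite /completion_dist; apply/eqP; rewrite eq_le; apply/andP; split.
- rewrite (le_trans (cauchy_dist_triangle u _ _))// h add0r.
  by rewrite (le_trans (cauchy_dist_triangle v _ _))// (cauchy_distC v) h addr0.
- rewrite (le_trans (cauchy_dist_triangle (repr (\pi_completion u)) _ _))//.
  rewrite cauchy_distC h add0r.
  rewrite (le_trans (cauchy_dist_triangle (repr (\pi_completion v)) _ _))//.
  by rewrite h addr0.
Qed.

Lemma completion_distxx x : completion_dist x x = 0.
Proof. exact: cauchy_distxx. Qed.

Lemma completion_dist_positivity x y : completion_dist x y = 0 -> x = y.
Proof.
move=> xy; rewrite -[x]reprK -[y]reprK; apply/eqP; rewrite eqmodE.
by rewrite /= /cauchy_equiv -/(completion_dist x y) xy.
Qed.

Lemma completion_distC x y : completion_dist x y = completion_dist y x.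
Proof. exact: cauchy_distC. Qed.

Lemma completion_dist_triangle y x z :
  completion_dist x z <= completion_dist x y + completion_dist y z.
Proof. exact: cauchy_dist_triangle. Qed.

HB.instance Definition _ := isMetric.Build R completion
  completion_distxx completion_dist_positivity completion_distC
  completion_dist_triangle.

Lemma cst_cauchy (x : T) : `[< cauchy ((fun _ : nat => x) @ \oo) >].
Proof.
by apply/asboolP/cauchy_seqP => e e0; exists 0%N => i j _ _; rewrite mdistxx.
Qed.

Definition to_completion (x : T) : completion :=
  \pi_completion (exist _ (fun=> x) (cst_cauchy x) : cauchy_seq).

Lemma to_completion_isometry x y :
  mdist (to_completion x) (to_completion y) = mdist x y.
Proof. by rewrite [LHS]completion_distE /cauchy_dist /= lim_cst. Qed.

Lemma completion_dist_to (u : cauchy_seq) (e : R) : 0 < e ->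
  exists N, forall i, (N <= i)%N ->
    mdist (\pi_completion u) (to_completion (val u i)) <= e.
Proof.
move=> e0; have [N hN] := cauchy_seq_near u e0; exists N => i Ni.
rewrite [leLHS]completion_distE; apply: limr_le; first exact: cauchy_seq_cvg.
by exists N => // j /= Nj; apply/ltW/hN.
Qed.

Lemma to_completion_approx (x : completion) (e : R) : 0 < e ->
  exists t, mdist x (to_completion t) <= e.
Proof.
move=> e0; have [N hN] := completion_dist_to (repr x) e0.
by exists (val (repr x) N); have := hN _ (leqnn N); rewrite reprK.
Qed.

Lemma to_completion_dense : dense (range to_completion).
Proof.
move=> U [x Ux] oU; have /nbhs_ballP[e /= e0 eU] := open_nbhs_nbhs (conj oU Ux).
have e20 : 0 < e / 2 by rewrite divr_gt0.
have [t ht] := to_completion_approx x e20.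
exists (to_completion t); split; last by exists t.
apply: eU; rewrite ballEmdist /= (le_lt_trans ht)//.
by rewrite ltr_pdivrMr// ltr_pMr// ltr1n.
Qed.

Lemma completion_complete (F : set_system completion) :
  ProperFilter F -> cauchy F -> exists x : completion, F --> x.
Proof.
move=> FF /cauchyP cF.
pose e n : R := n.+1%:R^-1.
have e0 n : 0 < e n by rewrite invr_gt0.
have /choice[t ht] : forall n, exists t, F (ball (to_completion t) (2 * e n)).
  move=> n; have [x Fx] := cF _ (e0 n).
  have [t ht] := to_completion_approx x (e0 n); exists t.
  apply: filterS Fx => y; rewrite !ballEmdist /= => xy.
  rewrite (le_lt_trans (metric_triangle _ x _))// mulr_natl mulr2n.
  by rewrite ler_ltD// metric_sym.
have eN d : 0 < d -> exists N, forall i, (N <= i)%N -> e i < d.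
  move=> d0; have [N _ hN] := near_infty_natSinv_lt (PosNum d0).
  by exists N => i; exact: hN.
have ct : cauchy (t @ \oo).
  apply/cauchy_seqP => d d0; have d40 : 0 < d / 4 by rewrite divr_gt0.
  have [N hN] := eN _ d40.
  exists N => i j Ni Nj; rewrite -to_completion_isometry.
  have [y] := filter_ex (filterI (ht i) (ht j)).
  rewrite !ballEmdist => -[/= yi yj].
  rewrite (le_lt_trans (metric_triangle _ y _))// (metric_sym y).
  have := hN _ Ni; have := hN _ Nj => hj hi.
  rewrite (lt_trans (ltrD yi yj))// -mulrDr.
  rewrite (@lt_le_trans _ _ (2 * (d / 4 + d / 4)))// ?ltr_pM2l ?ltrD//.
  by lra.
pose u : cauchy_seq := exist _ t (introT (asboolP _) ct).
exists (\pi_completion u); apply/fcvgrPdist_lt => d d0.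
have d40 : 0 < d / 4 by rewrite divr_gt0.
have [N1 h1] := completion_dist_to u d40; have [N2 h2] := eN _ d40.
pose i := maxn N1 N2; near=> y.
rewrite (le_lt_trans (metric_triangle _ (to_completion (t i)) _))//.
have yi : mdist (to_completion (t i)) y < 2 * e i.
  by near: y; have := ht i; rewrite ballEmdist.
rewrite (lt_le_trans (ler_ltD (h1 i (leq_maxl _ _)) yi))//.
rewrite (le_trans (lerD (lexx _) (ler_wpM2l _ (ltW (h2 i (leq_maxr _ _))))))//.
by lra.
Unshelve. all: by end_near. Qed.

End cauchy_sequences.

(* A group norm: what an invariant metric d(x, y) = N (x - y) amounts to. No
   compatibility with integer multiples is required, unlike in
   [normedZmodType]. *)
Record group_norm (R : realType) (V : zmodType) := GroupNorm {
  gnorm :> V -> R;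
  gnorm0 : gnorm 0 = 0;
  gnorm_eq0 : forall x, gnorm x = 0 -> x = 0;
  gnormN : forall x, gnorm (- x) = gnorm x;
  gnormD : forall x y, gnorm (x + y) <= gnorm x + gnorm y
}.

Lemma invariant_metric_sub_continuous (R : realType) (M : metricType R)
    (sub : M -> M -> M) :
  (forall x y x' y',
     mdist (sub x y) (sub x' y') <= mdist x x' + mdist y y') ->
  continuous (fun x : M * M => sub x.1 x.2).
Proof.
move=> h [x y]; apply/cvgrPdist_lt => e e0 /=.
have e20 : 0 < e / 2 by rewrite divr_gt0.
exists (ball x (e / 2), ball y (e / 2)).
  by split; exact: nbhsx_ballx.
move=> [x' y'] /= []; rewrite !ballEmdist /= => hx hy.
by rewrite (le_lt_trans (h _ _ _ _))// [ltRHS]splitr ltrD.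
Qed.

(* An alias of V carrying the topology of N; it must mention N, so that the
   instances below can depend on it. *)
Definition normed_by (R : realType) (V : zmodType) (N : group_norm R V) :
  Type := V.

Section normed_group.
Context {R : realType} {V : zmodType} (N : group_norm R V).
Local Notation normed_by := (normed_by N).

HB.instance Definition _ := GRing.Zmodule.on normed_by.

Let dist (x y : normed_by) : R := N (x - y).

Lemma dist_normed_xx x : dist x x = 0.
Proof. by rewrite /dist subrr gnorm0. Qed.

Lemma dist_normed_positivity x y : dist x y = 0 -> x = y.
Proof. by move=> /gnorm_eq0/eqP; rewrite subr_eq0 => /eqP. Qed.

Lemma dist_normedC x y : dist x y = dist y x.
Proof. by rewrite /dist -gnormN opprB. Qed.

Lemma dist_normed_triangle y x z : dist x z <= dist x y + dist y z.
Proof. by rewrite /dist (le_trans _ (gnormD _ _ _))// addrA subrK. Qed.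

HB.instance Definition _ := isMetric.Build R normed_by
  dist_normed_xx dist_normed_positivity dist_normedC dist_normed_triangle.

Lemma mdist_normedE (x y : normed_by) : mdist x y = N (x - y).
Proof. by []. Qed.

Lemma mdist_normed_sub (x y x' y' : normed_by) :
  mdist (x - y) (x' - y') <= mdist x x' + mdist y y'.
Proof.
rewrite !mdist_normedE opprB [y' - x']addrC addrACA.
by rewrite (le_trans (gnormD _ _ _))// lerD2l -gnormN opprD opprK.
Qed.

Lemma mdist_normed_opp (x x' : normed_by) : mdist (- x) (- x') = mdist x x'.
Proof. by rewrite !mdist_normedE -gnormN opprD !opprK. Qed.

Lemma mdist_normed_add (x y x' y' : normed_by) :
  mdist (x + y) (x' + y') <= mdist x x' + mdist y y'.
Proof.
rewrite -(mdist_normed_opp y) -{1}[y]opprK -{1}[y']opprK.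
exact: mdist_normed_sub.
Qed.

HB.instance Definition _ := PreTopologicalNmodule_isTopologicalZmodule.Build
  normed_by (invariant_metric_sub_continuous mdist_normed_sub).

Local Notation C := (completion normed_by).

Lemma cauchy_add (u v : cauchy_seq normed_by) :
  `[< cauchy ((fun n => val u n + val v n : normed_by) @ \oo) >].
Proof.
apply/asboolP/cauchy_seqP => e e0; have e20 : 0 < e / 2 by rewrite divr_gt0.
have [N1 h1] := cauchy_seq_near u e20; have [N2 h2] := cauchy_seq_near v e20.
exists (maxn N1 N2) => i j; rewrite !geq_max => /andP[i1 i2] /andP[j1 j2].
rewrite (le_lt_trans (mdist_normed_add _ _ _ _))//.
by rewrite [ltRHS]splitr ltrD ?h1 ?h2.
Qed.

Lemma cauchy_opp (u : cauchy_seq normed_by) :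
  `[< cauchy ((fun n => - val u n : normed_by) @ \oo) >].
Proof.
apply/asboolP/cauchy_seqP => e /(cauchy_seq_near u)[N1 h1].
by exists N1 => i j Ni Nj; rewrite mdist_normed_opp h1.
Qed.

Definition cauchy_seq_add u v : cauchy_seq normed_by :=
  Sub (fun n => val u n + val v n) (cauchy_add u v).

Definition cauchy_seq_opp u : cauchy_seq normed_by :=
  Sub (fun n => - val u n) (cauchy_opp u).

Lemma cauchy_dist_add u v u' v' :
  cauchy_dist (cauchy_seq_add u v) (cauchy_seq_add u' v') <=
  cauchy_dist u u' + cauchy_dist v v'.
Proof.
rewrite /cauchy_dist -limD; [|exact: cauchy_seq_cvg..].
apply: ler_lim; [exact: cauchy_seq_cvg| |].
  by apply: is_cvgD; exact: cauchy_seq_cvg.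
by apply: nearW => n /=; exact: mdist_normed_add.
Qed.

Lemma cauchy_dist_opp u u' :
  cauchy_dist (cauchy_seq_opp u) (cauchy_seq_opp u') = cauchy_dist u u'.
Proof.
by congr (limn _); apply/funext => n /=; rewrite mdist_normed_opp.
Qed.

Lemma eq_pi_completion (u v : cauchy_seq normed_by) :
  (forall n, val u n = val v n) -> \pi_C u = \pi_C v.
Proof. by move=> uv; congr (\pi_C _); apply/val_inj/funext. Qed.

Definition completion_add (x y : C) : C :=
  \pi_C (cauchy_seq_add (repr x) (repr y)).

Definition completion_opp (x : C) : C := \pi_C (cauchy_seq_opp (repr x)).

Definition completion_zero : C := to_completion (0 : normed_by).

Lemma completion_addE u v :
  completion_add (\pi_C u) (\pi_C v) = \pi_C (cauchy_seq_add u v).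
Proof.
apply: mdist_positivity; rewrite [LHS]completion_distE.
apply/eqP; rewrite eq_le cauchy_dist_ge0 andbT.
rewrite (le_trans (cauchy_dist_add _ _ _ _))// -!completion_distE !reprK.
by rewrite !completion_distxx addr0.
Qed.

Lemma completion_oppE u : completion_opp (\pi_C u) = \pi_C (cauchy_seq_opp u).
Proof.
apply: mdist_positivity; rewrite [LHS]completion_distE.
by rewrite cauchy_dist_opp -completion_distE reprK completion_distxx.
Qed.

Lemma completion_addA : associative completion_add.
Proof.
move=> x y z; rewrite -[x]reprK -[y]reprK -[z]reprK.
set u := repr x; set v := repr y; set w := repr z.
rewrite (completion_addE v w) (completion_addE u v) !completion_addE.
by apply: eq_pi_completion => n /=; rewrite addrA.
Qed.

Lemma completion_addC : commutative completion_add.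
Proof.
move=> x y; rewrite -[x]reprK -[y]reprK !completion_addE.
by apply: eq_pi_completion => n /=; rewrite addrC.
Qed.

Lemma completion_add0 : left_id completion_zero completion_add.
Proof.
move=> x; rewrite -[x]reprK !completion_addE.
by apply: eq_pi_completion => n /=; rewrite add0r.
Qed.

Lemma completion_addN :
  left_inverse completion_zero completion_opp completion_add.
Proof.
move=> x; rewrite -[x]reprK completion_oppE !completion_addE.
by apply: eq_pi_completion => n /=; rewrite addNr.
Qed.

HB.instance Definition _ := GRing.isZmodule.Build C
  completion_addA completion_addC completion_add0 completion_addN.

Lemma mdist_completion_sub (x y x' y' : C) :
  mdist (x - y) (x' - y') <= mdist x x' + mdist y y'.
Proof.
rewrite -[x]reprK -[y]reprK -[x']reprK -[y']reprK.
rewrite /GRing.add /GRing.opp /= !completion_oppE !completion_addE.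
rewrite [leLHS]completion_distE (le_trans (cauchy_dist_add _ _ _ _))//.
by rewrite cauchy_dist_opp -!completion_distE.
Qed.

HB.instance Definition _ := PreTopologicalNmodule_isTopologicalZmodule.Build C
  (invariant_metric_sub_continuous mdist_completion_sub).

Lemma to_completionB (x y : normed_by) :
  to_completion (x - y) = to_completion x - to_completion y.
Proof.
rewrite /GRing.add /GRing.opp /= !completion_oppE !completion_addE.
exact: eq_pi_completion.
Qed.

End normed_group.

Section generated_group.
Context {V : zmodType} (w : nat -> V).

Definition is_subgroup (H : set V) :=
  H 0 /\ (forall x y, H x -> H y -> H (x - y)).

Definition generated : set V := smallest is_subgroup (range w).

Lemma generated_subgroup : is_subgroup generated.
Proof.
split=> [H [[H0 _] _] //|x y Gx Gy H hH].
by case: (hH) => -[_ HB] _; apply: HB; [exact: Gx|exact: Gy].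
Qed.

Definition generated_pred : {pred V} := fun x => `[< generated x >].

Record generated_group := GeneratedGroup {
  generated_val :> V;
  _ : generated_val \in generated_pred
}.

HB.instance Definition _ := [isSub for generated_val].
HB.instance Definition _ := [Choice of generated_group by <:].

Lemma generated_predP x : reflect (generated x) (x \in generated_pred).
Proof. exact: asboolP. Qed.

Lemma generated_zmod_closed : zmod_closed generated_pred.
Proof.
case: generated_subgroup => G0 GB; split; first exact/generated_predP.
by move=> x y /generated_predP Gx /generated_predP Gy; apply/generated_predP;
exact: GB.
Qed.

HB.instance Definition _ :=
  GRing.isZmodClosed.Build V generated_pred generated_zmod_closed.
HB.instance Definition _ :=
  [SubChoice_isSubZmodule of generated_group by <:].

End generated_group.

Section sigma.
Context {R : realType} {V : zmodType} (w : nat -> V) (p : nat -> R).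

Definition combination_costs (x : V) : set R :=
  [set s | exists (N : nat) (c : nat -> int),
     x = \sum_(j < N) w j *~ c j /\ s = \sum_(j < N) `|c j|%:~R * p j].

Definition sigma (x : V) : R := inf (combination_costs x).

Lemma combination_costs0 : combination_costs 0 0.
Proof. by exists 0%N, (fun=> 0); rewrite !big_ord0. Qed.

Lemma combination_costsN x s :
  combination_costs x s -> combination_costs (- x) s.
Proof.
move=> [N [c [-> ->]]]; exists N, (fun j => - c j); split.
  by rewrite -sumrN; apply: eq_bigr => j _; rewrite mulrNz.
by apply: eq_bigr => j _; rewrite normrN.
Qed.

Lemma combination_pad N N' (c : nat -> int) : (N <= N')%N ->
  let c' j := if (j < N)%N then c j else 0 in
  \sum_(j < N) w j *~ c j = \sum_(j < N') w j *~ c' j /\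
  \sum_(j < N) `|c j|%:~R * p j = \sum_(j < N') `|c' j|%:~R * p j.
Proof.
move=> NN' c'; split.
  rewrite (big_ord_widen N' (fun j => w j *~ c j))// big_mkcond.
  by apply: eq_bigr => j _; rewrite /c'; case: ifP => //; rewrite mulr0z.
rewrite (big_ord_widen N' (fun j => `|c j|%:~R * p j))// big_mkcond.
by apply: eq_bigr => j _; rewrite /c'; case: ifP => //; rewrite normr0 mul0r.
Qed.

Hypothesis p_gt0 : forall j, 0 < p j.

Lemma combination_costsD x y s t :
  combination_costs x s -> combination_costs y t ->
  exists2 u, combination_costs (x + y) u & u <= s + t.
Proof.
move=> [N1 [c1 [-> ->]]] [N2 [c2 [-> ->]]].
pose d1 j : int := if (j < N1)%N then c1 j else 0.
pose d2 j : int := if (j < N2)%N then c2 j else 0.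
have [-> ->] := combination_pad c1 (leq_addr N2 N1).
have [-> ->] := combination_pad c2 (leq_addl N1 N2).
rewrite -/d1 -/d2.
exists (\sum_(j < N1 + N2) `|d1 j + d2 j|%:~R * p j).
  exists (N1 + N2)%N, (fun j => d1 j + d2 j); split => //.
  by rewrite -big_split; apply: eq_bigr => j _; rewrite mulrzDr.
rewrite -big_split; apply: ler_sum => j _ /=.
by rewrite -mulrDl ler_pM2r// -intrD ler_int ler_normD.
Qed.

Lemma combination_costs_ge0 x s : combination_costs x s -> 0 <= s.
Proof.
move=> [N [c [_ ->]]]; apply: sumr_ge0 => j _.
by rewrite mulr_ge0 ?ler0z// ltW.
Qed.

Lemma combination_costs_lb x : has_lbound (combination_costs x).
Proof. by exists 0 => s /combination_costs_ge0. Qed.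

Lemma generatedP x :
  generated w x <-> exists s, combination_costs x s.
Proof.
split.
  move: x; apply: smallest_sub; last first.
    move=> _ [j _ <-].
    exists (\sum_(i < j.+1) `|Posz (i == j :> nat)|%:~R * p i), j.+1.
    exists (fun i => Posz (i == j :> nat)); split=> //.
    rewrite big_ord_recr /= eqxx mulr1z big1 ?add0r// => i _.
    by rewrite (ltn_eqF (ltn_ord i)) mulr0z.
  split; first by exists 0; exact: combination_costs0.
  move=> x y [s hs] [t /combination_costsN ht].
  by have [u hu _] := combination_costsD hs ht; exists u.
have [G0 GB] := generated_subgroup w.
have GN y : generated w y -> generated w (- y).
  by rewrite -[- y]add0r; exact: GB.
have GD y z : generated w y -> generated w z -> generated w (y + z).
  by move=> hy hz; rewrite -[z]opprK; apply: GB => //; exact: GN.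
have GM y n : generated w y -> generated w (y *+ n).
  by move=> hy; elim: n => [|n ih]; rewrite ?mulr0n// mulrS; exact: GD.
move=> [_ [N [c [-> _]]]]; elim/big_ind : _ => // j _.
have Gw : generated w (w j) by move=> H [_]; apply; exists (val j).
by case: (c j) => k; rewrite ?NegzE ?mulrNz; [|apply: GN]; exact: GM.
Qed.

Lemma combination_costs_has_inf x :
  generated w x -> has_inf (combination_costs x).
Proof. by move=> /generatedP ?; split=> //; exact: combination_costs_lb. Qed.

Lemma sigma_le x s : combination_costs x s -> sigma x <= s.
Proof. by move=> hs; apply: ge_inf => //; exact: combination_costs_lb. Qed.

Lemma sigma0 : sigma 0 = 0.
Proof.
apply/eqP; rewrite eq_le sigma_le//=; last exact: combination_costs0.
apply: lb_le_inf; first by exists 0; exact: combination_costs0.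
by move=> s /combination_costs_ge0.
Qed.

Lemma sigmaN x : sigma (- x) = sigma x.
Proof.
congr inf; apply/seteqP; split=> s /combination_costsN //.
by rewrite opprK.
Qed.

Lemma sigmaD x y : generated w x -> generated w y ->
  sigma (x + y) <= sigma x + sigma y.
Proof.
move=> /combination_costs_has_inf hx /combination_costs_has_inf hy.
apply/ler_addgt0Pl => e e0; have e20 : 0 < e / 2 by rewrite divr_gt0.
have [s hs sx] := inf_adherent e20 hx; have [t ht ty] := inf_adherent e20 hy.
have [u /sigma_le hu ust] := combination_costsD hs ht.
rewrite (le_trans hu)// (le_trans ust)//.
rewrite (le_trans (ltW (ltrD sx ty)))// /sigma; lra.
Qed.

End sigma.

Definition euclidean_norm {R : realType} {n : nat} (v : 'rV[R]_n) : R :=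
  Num.sqrt (\sum_i v ord0 i ^+ 2).

(* Sequences are indexed from 0: the j-th term here is the (j+1)-st term of a
   sequence indexed by {1, 2, ...}. *)
Record snp (R : realType) (n : nat) := SNP {
  snp_vec : nat -> 'rV[R]_n;
  snp_wt : nat -> R;
  snp_wt_noninc : nonincreasing_seq snp_wt;
  snp_wt_gt0 : forall j, 0 < snp_wt j;
  snp_wt_cvg : snp_wt @ \oo --> (0 : R);
  snp_vec_neq0 : forall j, snp_vec j != 0;
  snp_vec_nondec : nondecreasing_seq (fun j => euclidean_norm (snp_vec j));
  snp_ratio : exists2 d : R, 0 < d & forall j,
    d <= snp_wt j.+1 * euclidean_norm (snp_vec j.+1)
           / euclidean_norm (snp_vec j)
}.

(* 'rV[R]_(n + m) stands for R^n x R^m; no norm on it is used. *)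
Definition enp_vec (R : realType) (n m : nat) (s : snp R n)
    (q : nat -> 'rV[R]_m) (j : nat) : 'rV[R]_(n + m) :=
  row_mx (snp_vec s j) (q j).

Section enp_group.
Context {R : realType} {n m : nat} (s : snp R n) (q : nat -> 'rV[R]_m).

Local Notation w := (enp_vec s q).
Local Notation v := (snp_vec s).
Local Notation p := (snp_wt s).

Lemma euclidean_norm_gt0 k (x : 'rV[R]_k) : x != 0 -> 0 < euclidean_norm x.
Proof.
move=> x0; rewrite sqrtr_gt0 lt_neqAle sumr_ge0 ?andbT; last first.
  by move=> i _; exact: sqr_ge0.
apply: contra x0; rewrite eq_sym psumr_eq0; last by move=> i _; exact: sqr_ge0.
move=> /allP h; apply/eqP/rowP => i; rewrite mxE.
by apply/eqP; rewrite -sqrf_eq0; have := h i; apply; rewrite mem_index_enum.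
Qed.

Lemma ler_euclidean_norm k (x : 'rV[R]_k) (i : 'I_k) :
  `|x ord0 i| <= euclidean_norm x.
Proof.
rewrite -sqrtr_sqr ler_sqrt; last by apply: sumr_ge0 => j _; exact: sqr_ge0.
by rewrite (bigD1 i)//= lerDl sumr_ge0// => j _; exact: sqr_ge0.
Qed.

Lemma euclidean_norm_le k (x : 'rV[R]_k) :
  euclidean_norm x <= \sum_i `|x ord0 i|.
Proof.
rewrite -[leRHS]ger0_norm ?sumr_ge0// -sqrtr_sqr ler_sqrt ?sqr_ge0//.
rewrite expr2 mulr_suml; apply: ler_sum => i _.
rewrite -real_normK ?num_real// expr2 ler_wpM2l// (bigD1 i)//= lerDl.
by rewrite sumr_ge0.
Qed.

Let L (x : 'rV[R]_(n + m)) : R := \sum_i `|lsubmx x ord0 i|.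

Lemma enp_L_le (x y : 'rV[R]_(n + m)) : L (x + y) <= L x + L y.
Proof.
rewrite -big_split; apply: ler_sum => i _; rewrite linearD mxE /=.
exact: ler_normD.
Qed.

Lemma enp_LM (x : 'rV[R]_(n + m)) (c : int) : L (x *~ c) = `|c|%:~R * L x.
Proof.
rewrite mulr_sumr; apply: eq_bigr => i _.
by rewrite -scaler_int linearZ mxE normrM intr_norm.
Qed.

Lemma enp_cost_bound (d : R) x t : 0 < d ->
  (forall j, d * euclidean_norm (v j) <= p j.+1 * euclidean_norm (v j.+1)) ->
  combination_costs w p x t ->
  x = 0 \/ exists J, p J <= t /\
    d * euclidean_norm (v J) <= d * L x + n%:R * t * euclidean_norm (v J).
Proof.
move=> d0 hd [N [c [-> ->]]] {x t}; elim: N => [|N ih].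
  by left; rewrite big_ord0.
rewrite !big_ord_recr /=; have [->|cN] := eqVneq (c N) 0.
  by rewrite mulr0z normr0 mul0r !addr0.
right; exists N; set A := \sum_(i < N) `|c i|%:~R * p i.
have A0 : 0 <= A.
  by apply: sumr_ge0 => i _; rewrite mulr_ge0 ?ler0z// ltW// snp_wt_gt0.
have c1 : 1 <= `|c N|%:~R :> R by rewrite ler1z -gtz0_ge1 normr_gt0.
have p0 : 0 < p N := snp_wt_gt0 s N.
have pcN : p N <= `|c N|%:~R * p N by rewrite ler_peMl// ltW.
split; first by rewrite (le_trans pcN)// lerDr.
set y := \sum_(i < N) _; set e := euclidean_norm (v N).
have e0 : 0 < e by exact/euclidean_norm_gt0/snp_vec_neq0.
have Lw j : euclidean_norm (v j) <= L (w j).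
  by rewrite /L row_mxKl euclidean_norm_le.
have Lwn j : L (w j) <= n%:R * euclidean_norm (v j).
  rewrite /L row_mxKl.
  rewrite (le_trans (ler_sum _ (fun i _ => ler_euclidean_norm _ i)))//.
  by rewrite sumr_const card_ord mulr_natl.
have Ly : d * L y <= n%:R * A * e.
  have : L y <= \sum_(i < N) `|c i|%:~R * L (w i).
    rewrite /y; elim/big_ind2 : _ => [|x1 x2 y1 y2 h1 h2|i _].
    - by rewrite /L big1// => i _; rewrite linear0 mxE normr0.
    - by rewrite (le_trans (enp_L_le _ _))// lerD.
    - by rewrite enp_LM.
  rewrite -(ler_pM2l d0) => /le_trans; apply.
  rewrite -mulrA mulr_suml !mulr_sumr; apply: ler_sum => i _.
  rewrite mulrCA -!mulrA [leRHS]mulrCA ler_wpM2l ?ler0z//.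
  rewrite (le_trans (ler_wpM2l (ltW d0) (Lwn i)))// mulrCA ler_wpM2l//.
  have [N' NE] : exists N', N = N'.+1 by case: (N) (i) => [[]//|k _]; exists k.
  rewrite (@le_trans _ _ (d * euclidean_norm (v N')))//.
    rewrite ler_pM2l//; apply: snp_vec_nondec.
    by rewrite -ltnS -NE.
  rewrite (le_trans (hd N'))// -NE ler_wpM2r ?(ltW e0)//.
  by apply: snp_wt_noninc; exact: ltnW.
have LwN : e <= L (y + w N *~ c N) + L y.
  rewrite (le_trans (Lw N))// (@le_trans _ _ (L (w N *~ c N)))//.
    by rewrite enp_LM ler_peMl// /L sumr_ge0.
  rewrite -{1}[w N *~ c N](addKr y) addrC (le_trans (enp_L_le _ _))// lerD2l.
  by rewrite -[- y]mulrN1z enp_LM normrN normr1 mul1r.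
rewrite (le_trans (ler_wpM2l (ltW d0) LwN))// mulrDr lerD2l (le_trans Ly)//.
by rewrite ler_pM2r// ler_wpM2l// lerDl mulr_ge0// ?ler0z// ltW.
Qed.

Lemma sigma_enp_eq0 x : generated w x -> sigma w p x = 0 -> x = 0.
Proof.
move=> Gx x0; have [d d0 hd] := snp_ratio s.
have v0 j : 0 < euclidean_norm (v j) by exact/euclidean_norm_gt0/snp_vec_neq0.
have {}hd j : d * euclidean_norm (v j) <= p j.+1 * euclidean_norm (v j.+1).
  by rewrite -ler_pdivlMr.
have L0 : 0 <= L x by rewrite /L sumr_ge0.
pose M := 2 * L x + 1; have M0 : 0 < M by rewrite /M; lra.
pose t0 := Num.min (p 0%N)
  (Num.min (d / (2 * n.+1%:R)) (d * euclidean_norm (v 0%N) / M)).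
have p00 := snp_wt_gt0 s 0.
have n0 : 0 < 2 * n.+1%:R :> R by rewrite mulr_gt0.
have t00 : 0 < t0 by rewrite !lt_min p00 !divr_gt0 ?mulr_gt0.
have [t ht] := inf_adherent t00 (combination_costs_has_inf (snp_wt_gt0 s) Gx).
rewrite -/(sigma w p x) x0 add0r !lt_min => /and3P[tp tn tM].
have t_ge0 := combination_costs_ge0 (snp_wt_gt0 s) ht.
have [//|[J [pJ hJ]]] := enp_cost_bound d0 hd ht; exfalso.
have nt : n%:R * t <= d / 2.
  move: tn; rewrite ltr_pdivlMr// => tn.
  have : n%:R * t <= n.+1%:R * t by rewrite ler_wpM2r// ler_nat.
  nra.
have vM : euclidean_norm (v J) <= M.
  have h : n%:R * t * euclidean_norm (v J) <= d / 2 * euclidean_norm (v J).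
    by rewrite ler_pM2r.
  rewrite -(ler_pM2l d0) /M; nra.
case: J pJ hJ vM => [|J] pJ _ vM.
  by move: (le_lt_trans pJ tp); rewrite ltxx.
move: tM; rewrite ltr_pdivlMr//; apply/negP; rewrite -leNgt.
rewrite (@le_trans _ _ (d * euclidean_norm (v J)))//.
  by rewrite ler_pM2l//; exact: snp_vec_nondec.
by rewrite (le_trans (hd J))// ler_pM// ltW// snp_wt_gt0.
Qed.

Definition enp_sigma (x : generated_group w) : R := sigma w p (val x).

Lemma enp_sigma0 : enp_sigma 0 = 0.
Proof. exact/sigma0/snp_wt_gt0. Qed.

Lemma enp_sigma_eq0 x : enp_sigma x = 0 -> x = 0.
Proof.
by move=> x0; apply/val_inj/sigma_enp_eq0 => //; exact/generated_predP/valP.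
Qed.

Lemma enp_sigmaN x : enp_sigma (- x) = enp_sigma x.
Proof. exact: sigmaN. Qed.

Lemma enp_sigmaD x y : enp_sigma (x + y) <= enp_sigma x + enp_sigma y.
Proof.
by apply: sigmaD; [exact: snp_wt_gt0|exact/generated_predP/valP..].
Qed.

Definition enp_norm : group_norm R (generated_group w) :=
  GroupNorm enp_sigma0 enp_sigma_eq0 enp_sigmaN enp_sigmaD.

Definition enp_group := normed_by enp_norm.

End enp_group.

(* Main.v *)
(* By the growth condition, an integer combination of the v_j with small cost
   sum |c_j| p_j satisfies |c_j| ||v_j|| <= ||v_{j+1}|| - ||v_j||, so its top term
   is longer than the sum of the others and the combination is nonzero. Hence near
   0 the norm of a combination of the w_j is exactly its cost, and a ball of the
   completion is isometric to a ball of the weighted l^1 space of integer sequences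
   { c : sum |c_j| p_j < oo }, a space of complete Erdős type: neither the v_j nor
   the q_j matter any more. Coordinates are locally constant there, which gives
   local total disconnectedness; on spheres the metric topology is that of
   coordinatewise convergence, so small spheres are zero-dimensional and the
   dimension is at most one; Erdős' greedy argument shows that bounded
   neighbourhoods of 0 have boundary points; and multiples of the generators of
   fixed size are uniformly separated, which excludes local compactness. *)

Require Import Defs.
From mathcomp Require Import all_boot all_order all_algebra.
From mathcomp Require Import all_classical all_reals all_analysis.
From mathcomp Require Import ring lra.

Import Order.TTheory GRing.Theory Num.Theory.
Import numFieldNormedType.Exports.

Local Open Scope classical_set_scope.
Local Open Scope ring_scope.

Set Implicit Arguments.
Unset Strict Implicit.
Unset Printing Implicit Defensive.

(** * Finite integer combinations and their weighted [l^1] cost *)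

Section combinations.
Context {R : realType} {G : zmodType} (g : nat -> G) (p : nat -> R).
Implicit Types (c d : nat -> int) (k : nat).

Definition comb c k : G := \sum_(j < k) g j *~ c j.
Definition cost c k : R := \sum_(j < k) `|c j|%:~R * p j.

Lemma combS c k : comb c k.+1 = comb c k + g k *~ c k.
Proof. exact: big_ord_recr. Qed.

Lemma costS c k : cost c k.+1 = cost c k + `|c k|%:~R * p k.
Proof. exact: big_ord_recr. Qed.

Lemma combB c d k : comb (c \- d) k = comb c k - comb d k.
Proof.
by rewrite -sumrB; apply: eq_bigr => j _; rewrite mulrzBr.
Qed.

Lemma eq_comb c d k : (forall j, (j < k)%N -> c j = d j) -> comb c k = comb d k.
Proof. by move=> cd; apply: eq_bigr => j _; rewrite cd. Qed.

Lemma eq_cost c d k : (forall j, (j < k)%N -> c j = d j) -> cost c k = cost d k.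
Proof. by move=> cd; apply: eq_bigr => j _; rewrite cd. Qed.

Lemma comb_supp c k l : (forall j, (k <= j)%N -> c j = 0) -> (k <= l)%N ->
  comb c l = comb c k.
Proof.
move=> c0 /subnK <-; elim: (l - k)%N => [//|i ih].
by rewrite addSn combS ih c0 ?leq_addl// mulr0z addr0.
Qed.

Lemma cost_supp c k l : (forall j, (k <= j)%N -> c j = 0) -> (k <= l)%N ->
  cost c l = cost c k.
Proof.
move=> c0 /subnK <-; elim: (l - k)%N => [//|i ih].
by rewrite addSn costS ih c0 ?leq_addl// normr0 mul0r addr0.
Qed.

Hypothesis p_gt0 : forall j, 0 < p j.

Lemma cost_term_ge0 (a : int) k : 0 <= `|a|%:~R * p k :> R.
Proof. by rewrite mulr_ge0 ?ler0z// ltW. Qed.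

Lemma cost_nondec c k l : (k <= l)%N -> cost c k <= cost c l.
Proof.
move=> /subnK <-; elim: (l - k)%N => [//|i ih].
by rewrite addSn costS (le_trans ih)// lerDl cost_term_ge0.
Qed.

Lemma cost_ge0 c k : 0 <= cost c k.
Proof. by have := cost_nondec c (leq0n k); rewrite /cost big_ord0. Qed.

Lemma cost_coord c j k : (j < k)%N -> `|c j|%:~R * p j <= cost c k.
Proof.
move=> jk; rewrite (le_trans _ (cost_nondec c jk))// costS lerDr cost_ge0//.
Qed.

Lemma costB c d k : cost (c \- d) k <= cost c k + cost d k.
Proof.
rewrite -big_split; apply: ler_sum => j _ /=.
by rewrite -mulrDl ler_pM2r// -intrD ler_int ler_normB.
Qed.

(** The common head cancels, and the triangle inequality is applied to the tails only. *)
Lemma costB_tail c d k l : (forall j, (j < k)%N -> c j = d j) -> (k <= l)%N ->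
  cost (c \- d) l <= (cost c l - cost c k) + (cost d l - cost d k).
Proof.
move=> cd /subnK <-; elim: (l - k)%N => [|i ih].
  rewrite add0n !subrr addr0 /cost big1// => j _ /=.
  by rewrite cd// subrr normr0 mul0r.
have : `|c (i + k)%N - d (i + k)%N|%:~R * p (i + k)%N <=
    `|c (i + k)%N|%:~R * p (i + k)%N + `|d (i + k)%N|%:~R * p (i + k)%N.
  by rewrite -mulrDl ler_pM2r// -intrD ler_int ler_normB.
rewrite addSn !costS /=; move: ih; lra.
Qed.

(** A nonzero integer has absolute value at least 1. This discreteness later makes coordinates
    locally constant. *)
Lemma cost_small_eq0 (a : int) k : `|a|%:~R * p k < p k -> a = 0.
Proof.
rewrite gtr_pMl// -[1]/(1%:~R) ltr_int => a1; apply/eqP.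
by rewrite -normr_eq0 eq_le normr_ge0 andbT -ltzD1 add0r.
Qed.

End combinations.

(** * Groups normed by infimal cost, with no relations of small cost *)

Section free_up_to_small_cost.
Context {R : realType} {G : zmodType} (N : group_norm R G).
Context (g : nat -> G) (p : nat -> R) (r : R).
Hypothesis p_gt0 : forall j, 0 < p j.
Hypothesis p_noninc : nonincreasing_seq p.
Hypothesis p_cvg0 : p @ \oo --> (0 : R).
Hypothesis N_comb_le : forall c k, N (comb g c k) <= cost p c k.
Hypothesis N_lt_comb : forall x e, N x < e ->
  exists c k, x = comb g c k /\ cost p c k < e.
Hypothesis r_gt0 : 0 < r.
(* The bound is [4 * r] so that differences of combinations of cost less than
   [2 * r] are covered. *)
Hypothesis comb_free : forall c k, cost p c k < 4 * r -> comb g c k = 0 ->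
  forall j, (j < k)%N -> c j = 0.

Local Notation comb := (comb g).
Local Notation cost := (cost p).
Local Notation C := (completion (normed_by N)).
Local Notation "''i' x" := (to_completion (x : normed_by N) : C)
  (at level 8, x at level 2).

Lemma p_lt (e : R) : 0 < e -> exists k, forall j, (k <= j)%N -> p j < e.
Proof.
move=> e0; have /fcvgrPdist_lt/(_ _ e0)[k _ hk] := p_cvg0.
by exists k => j /hk /=; rewrite sub0r normrN gtr0_norm.
Qed.

(** Zero padding lets combinations of different lengths be compared at a common length. *)
Lemma truncate (c : nat -> int) k : exists2 d : nat -> int,
  forall j, (k <= j)%N -> d j = 0 & comb d k = comb c k /\ cost d k = cost c k.
Proof.
exists (fun j => if (j < k)%N then c j else 0).
  by move=> j; rewrite leqNgt => /negbTE ->.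
by split; [apply: eq_comb|apply: eq_cost] => j ->.
Qed.

(** A strictly cheaper representation would differ from [c] by a relation of cost below [4 * r],
    hence would have the same coefficients and the same cost. *)
Lemma N_comb c k : cost c k < 2 * r -> N (comb c k) = cost c k.
Proof.
move=> ck; apply/eqP; rewrite eq_le N_comb_le /= leNgt; apply/negP.
move=> /N_lt_comb[c' [k' [cc' c'k']]].
have [d d0 [dE dk]] := truncate c k.
have [d' d'0 [d'E d'k]] := truncate c' k'.
pose l := maxn k k'; have kl : (k <= l)%N := leq_maxl _ _.
have k'l : (k' <= l)%N := leq_maxr _ _.
have dd' j : (j < l)%N -> d j = d' j.
  move=> jl; apply/eqP; rewrite -subr_eq0.
  apply/eqP/(comb_free (c := d \- d') (k := l)) => //.
    rewrite (le_lt_trans (costB p_gt0 _ _ _))//.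
    rewrite (cost_supp _ d0 kl) (cost_supp _ d'0 k'l) dk d'k; lra.
  rewrite combB (comb_supp _ d0 kl) (comb_supp _ d'0 k'l) dE d'E cc'.
  exact: subrr.
move: c'k'; rewrite -dk -d'k -(cost_supp _ d0 kl) -(cost_supp _ d'0 k'l).
by rewrite (eq_cost _ dd') ltxx.
Qed.

(** * Coordinates near 0 in the completion *)

Lemma to_completion0 : 'i 0 = 0 :> C.
Proof. by []. Qed.

Lemma mdist_to_completion (x y : G) : mdist ('i x) ('i y) = N (x - y).
Proof. exact: to_completion_isometry. Qed.

Lemma mdist_subr2 (x y z : C) : mdist (y - x) (z - x) = mdist y z.
Proof.
apply/eqP; rewrite eq_le; apply/andP; split.
  by rewrite (le_trans (mdist_completion_sub _ _ _ _))// mdistxx addr0.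
have := mdist_completion_sub (y - x) (- x) (z - x) (- x).
by rewrite !opprK !subrK mdistxx addr0.
Qed.

Lemma mdist_sub0 (x y : C) : mdist (y - x) 0 = mdist y x.
Proof. by rewrite -[X in mdist _ X](subrr x) mdist_subr2. Qed.

(** Partial costs stay below [r] so that the difference of two expansions costs less than [2 * r],
    the range where [N_comb] is exact. *)
Definition expansion (x : C) (c : nat -> int) :=
  (forall k, cost c k < r) /\
  (forall e, 0 < e -> exists k, forall l, (k <= l)%N -> mdist x ('i (comb c l)) < e).

Lemma mdist_comb c d k : cost c k < r -> cost d k < r ->
  mdist ('i (comb c k)) ('i (comb d k)) = cost (c \- d) k.
Proof.
move=> ck dk; rewrite mdist_to_completion -combB N_comb//.
rewrite (le_lt_trans (costB p_gt0 _ _ _))//; lra.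
Qed.

(** Late partial sums approximate both points, and between partial sums the distance is exactly the
    cost, which only grows with the length. With [mdist_le_cost], distances are suprema of costs. *)
Lemma cost_le_mdist x y c d k : expansion x c -> expansion y d ->
  cost (c \- d) k <= mdist x y.
Proof.
move=> [cr cx] [dr dy]; apply/ler_addgt0Pl => e e0.
have e20 : 0 < e / 2 by rewrite divr_gt0.
have [k1 h1] := cx _ e20; have [k2 h2] := dy _ e20.
pose l := maxn k (maxn k1 k2).
have {}h1 : mdist x ('i (comb c l)) < e / 2.
  by apply: h1; rewrite !leq_max leqnn orbT.
have {}h2 : mdist y ('i (comb d l)) < e / 2.
  by apply: h2; rewrite !leq_max leqnn !orbT.
rewrite (le_trans (cost_nondec p_gt0 _ (leq_maxl k _ : (k <= l)%N)))//.
rewrite -mdist_comb// (le_trans (metric_triangle _ x _))// metric_sym.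
have := metric_triangle x y ('i (comb d l)); lra.
Qed.

Lemma mdist_le_cost x y c d k b : expansion x c -> expansion y d ->
  (forall l, (k <= l)%N -> cost (c \- d) l <= b) -> mdist x y <= b.
Proof.
move=> [cr cx] [dr dy] hb; apply/ler_addgt0Pl => e e0.
have e20 : 0 < e / 2 by rewrite divr_gt0.
have [k1 h1] := cx _ e20; have [k2 h2] := dy _ e20.
pose l := maxn k (maxn k1 k2).
have {}h1 : mdist x ('i (comb c l)) < e / 2.
  by apply: h1; rewrite !leq_max leqnn orbT.
have {}h2 : mdist y ('i (comb d l)) < e / 2.
  by apply: h2; rewrite !leq_max leqnn !orbT.
have := hb l (leq_maxl _ _); rewrite -mdist_comb//.
have := metric_triangle x ('i (comb c l)) y.
have := metric_triangle ('i (comb c l)) ('i (comb d l)) y.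
rewrite (metric_sym ('i (comb d l)) y); lra.
Qed.

(** Differing in a coordinate [j <= k] would already cost [p j >= p k]. *)
Lemma eq_expansion x y c d k : expansion x c -> expansion y d ->
  mdist x y < p k -> forall j, (j <= k)%N -> c j = d j.
Proof.
move=> cx dy xy j jk; apply/eqP; rewrite -subr_eq0; apply/eqP.
apply: (@cost_small_eq0 _ p p_gt0 _ j).
rewrite (le_lt_trans (cost_coord p_gt0 (c \- d) (ltnSn j)))//.
rewrite (le_lt_trans (cost_le_mdist _ cx dy))//.
by rewrite (lt_le_trans xy)// p_noninc.
Qed.

Lemma expansion_to_completion x : N x < r -> exists c, expansion ('i x) c.
Proof.
move=> /N_lt_comb[c' [k [-> c'k]]].
have [c c0 [cE ck]] := truncate c' k; exists c; split=> [l|e e0].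
  rewrite (le_lt_trans (cost_nondec p_gt0 _ (leq_maxl l k)))//.
  by rewrite (cost_supp _ c0 (leq_maxr l k)) ck.
by exists k => l kl; rewrite (comb_supp _ c0 kl) cE mdistxx.
Qed.

(** Close approximations from the group share their initial coefficients, so a diagonal sequence of
    coefficients can be read off. *)
Lemma expansion_exists (x : C) : mdist x 0 < r -> exists c, expansion x c.
Proof.
move=> xr.
have /choice[ya hya] : forall n, exists ya : G * (nat -> int),
    mdist x ('i ya.1) < p n / 2 /\ expansion ('i ya.1) ya.2.
  (* The first bound gives distance below [p n / 2]; the second keeps the norm of [t] below [r], so
     that it has an expansion. *)
  move=> n; pose e := Num.min (p n / 4) ((r - mdist x 0) / 2).
  have e0 : 0 < e by rewrite lt_min !divr_gt0// subr_gt0.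
  have [t ht] := to_completion_approx x e0.
  have et : e <= p n / 4 by rewrite ge_min lexx.
  have er : e <= (r - mdist x 0) / 2 by rewrite ge_min lexx orbT.
  have [|c hc] := @expansion_to_completion t; last first.
    by exists (t, c); split=> //=; have := p_gt0 n; move: ht et; rewrite /=; lra.
  have := metric_triangle ('i t) x 0.
  rewrite -to_completion0 mdist_to_completion subr0 metric_sym.
  move: ht er; rewrite to_completion0; lra.
have close m n : (n <= m)%N -> mdist ('i (ya n).1) ('i (ya m).1) < p n.
  move=> nm; have [h1 _] := hya n; have [h2 _] := hya m.
  rewrite (le_lt_trans (metric_triangle _ x _))// metric_sym.
  have := p_noninc nm; lra.
have agree m n j : (n <= m)%N -> (j <= n)%N -> (ya n).2 j = (ya m).2 j.
  have [_ hn] := hya n; have [_ hm] := hya m.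
  by move=> nm; exact: (eq_expansion hn hm (close _ _ nm)).
(* By [agree], coordinate [j] is frozen from the [j]-th approximation on. *)
pose c j := (ya j).2 j.
have cE m j : (j <= m)%N -> c j = (ya m).2 j by move=> jm; exact: agree.
exists c; split=> [k|e e0].
  rewrite (@eq_cost _ p c (ya k).2); last by move=> j /ltnW; exact: cE.
  by have [_ []] := hya k.
have e40 : 0 < e / 4 by rewrite divr_gt0.
have [n /(_ _ (leqnn n)) pn] := p_lt e40.
have [h1 h2] := hya n; have [h3 h4] := h2; have [k hk] := h4 _ e40.
(* Index [m] is late enough to agree with [c] below [l] and to lie within [p n] of approximation
   [n]. *)
exists k => l /hk hl; pose m := maxn n l.
have h5 : mdist ('i (comb (ya n).2 l)) ('i (comb c l)) <= p n.
  rewrite mdist_to_completion -combB (le_trans (N_comb_le _ _))//.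
  rewrite (@eq_cost _ p _ ((ya n).2 \- (ya m).2)); last first.
    move=> j jl /=; rewrite (cE m)// (leq_trans (ltnW jl))//.
    exact: leq_maxr.
  have [_ hm] := hya m.
  by rewrite (le_trans (cost_le_mdist _ h2 hm))// ltW// close// leq_maxl.
have := metric_triangle x ('i (ya n).1) ('i (comb c l)).
have := metric_triangle ('i (ya n).1) ('i (comb (ya n).2 l)) ('i (comb c l)).
lra.
Qed.

(** Points within [p n] of each other share their coordinates up to [n], so a condition on these is
    locally constant. *)
Lemma open_coordinates (x : C) n (P : (nat -> int) -> Prop) :
  (forall c d, (forall j, (j <= n)%N -> c j = d j) -> P c -> P d) ->
  open [set z | mdist z x < r /\ exists2 c, expansion (z - x) c & P c].
Proof.
move=> Pn; rewrite openE => z [zx [c cz Pc]].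
apply/nbhs_ballP; exists (Num.min (r - mdist z x) (p n)) => /=.
  by rewrite lt_min subr_gt0 zx p_gt0.
move=> y; rewrite ballEmdist /= lt_min => /andP[yz yn].
have yx : mdist y x < r.
  by have := metric_triangle y z x; rewrite (metric_sym y z); lra.
split=> //; have [|d dy] := @expansion_exists (y - x); first by rewrite mdist_sub0.
exists d => //; apply: Pn Pc; apply: (eq_expansion cz dy).
by rewrite mdist_subr2.
Qed.


Lemma expansion0 : expansion 0 (fun=> 0).
Proof.
split=> [k|e e0]; first by rewrite /cost big1// => j _; rewrite normr0 mul0r.
by exists 0%N => k _; rewrite /comb big1 ?mdistxx.
Qed.

Lemma cost_le_norm x c k : expansion x c -> cost c k <= mdist x 0.
Proof.
move=> cx; rewrite (le_trans _ (cost_le_mdist k cx expansion0))//.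
by rewrite (@eq_cost _ p (c \- _) c)// => j _ /=; rewrite subr0.
Qed.

Lemma norm_le_cost x c k b : expansion x c ->
  (forall l, (k <= l)%N -> cost c l <= b) -> mdist x 0 <= b.
Proof.
move=> cx hb; apply: (mdist_le_cost (k := k) cx expansion0) => l /hb.
by rewrite (@eq_cost _ p (c \- _) c)// => j _ /=; rewrite subr0.
Qed.

Lemma expansion_inj x y c : expansion x c -> expansion y c -> x = y.
Proof.
move=> cx cy; apply: mdist_positivity; apply/eqP; rewrite eq_le mdist_ge0 andbT.
apply: (mdist_le_cost (k := 0) cx cy) => l _.
by rewrite /cost big1// => j _ /=; rewrite subrr normr0 mul0r.
Qed.

(** * Clopen splitting by finitely many coordinates, and local total disconnectedness *)

Definition agreeing (x : C) n (c : nat -> int) : set C :=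
  [set z | mdist z x < r /\
    exists2 d, expansion (z - x) d & forall j, (j <= n)%N -> c j = d j].

Definition differing (x : C) n (c : nat -> int) : set C :=
  [set z | mdist z x < r /\
    exists2 d, expansion (z - x) d & ~ forall j, (j <= n)%N -> c j = d j].

Lemma open_agreeing x n c : open (agreeing x n c).
Proof.
apply: (@open_coordinates x n) => d e de cd j jn.
by rewrite cd// de.
Qed.

Lemma open_differing x n c : open (differing x n c).
Proof.
apply: (@open_coordinates x n) => d e de cd ce; apply: cd => j jn.
by rewrite ce// de.
Qed.

Lemma agreeing_disjoint x n c z : agreeing x n c z -> ~ differing x n c z.
Proof.
move=> [_ [d dz cd]] [_ [e ez ce]]; apply: ce => j jn; rewrite cd//.
by apply: (eq_expansion dz ez _ jn); rewrite mdistxx.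
Qed.

Lemma agreeing_or_differing x n c z : mdist z x < r ->
  ~ agreeing x n c z -> differing x n c z.
Proof.
move=> zx nz; split=> //; have [|d dz] := @expansion_exists (z - x).
  by rewrite mdist_sub0.
by exists d => // cd; apply: nz; split=> //; exists d.
Qed.

(** Inside the ball of radius [r], fixing finitely many coordinates is a clopen condition, so a
    connected set has constant coordinates, and these determine the point. *)
Lemma completion_locally_totally_disconnected : locally_totally_disconnected C.
Proof.
exists (ball (0 : C) r); first exact: nbhsx_ballx.
move=> x xr.
have x0 : mdist x 0 < r by move: xr; rewrite ballEmdist /= metric_sym.
apply/seteqP; split; last by move=> _ ->; exact: connected_component_refl.
move=> y [A [Ax Ar cA] Ay] /=.
have {}Ar z : A z -> mdist z 0 < r.
  by move=> /Ar; rewrite ballEmdist /= metric_sym.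
have [c cx] := expansion_exists x0; have [d dy] := expansion_exists (Ar _ Ay).
suff cd n : agreeing 0 n c y.
  apply: (expansion_inj (c := c)) => //; suff -> : c = d by [].
  apply/funext => n; have [_ [d' dy' cd']] := cd n.
  rewrite cd'//; apply: (@eq_expansion y y _ _ n _ dy) => //.
    by rewrite subr0 in dy'.
  by rewrite mdistxx.
suff : A `&` agreeing 0 n c = A by move=> AE; move: Ay; rewrite -AE => -[].
apply: cA.
- exists x; split=> //; split; first exact: Ar.
  by exists c; rewrite ?subr0.
- by exists (agreeing 0 n c) => //; exact: open_agreeing.
- exists (~` differing 0 n c); first exact/open_closedC/open_differing.
  apply/seteqP; split=> z [Az zc]; split=> //.
    exact: agreeing_disjoint zc.
  by apply: contrapT => nz; apply: zc; apply: agreeing_or_differing (Ar _ Az) nz.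
Qed.

(** * Upper bound on the dimension: small spheres have clopen bases *)

Lemma ind_lt1_clopen_base (T : topologicalType) :
  (forall (x : T) U, nbhs x U -> exists V, [/\ clopen V, V x & V `<=` U]) ->
  ind_lt 1 T.
Proof.
move=> hT x U /hT[V [[oV cV] Vx VU]]; exists V; split=> //= -[[y yV] _].
have [Vy nVy] := set_mem yV; apply: nVy.
by rewrite ((interior_id V).1 oV); exact: cV.
Qed.

(** [ind_lt 0] forces the boundary to be empty, which for an open set means being closed as well. *)
Lemma ind_lt1_clopen (T : topologicalType) (x : T) U : ind_lt 1 T ->
  nbhs x U -> exists V, [/\ clopen V, V x & V `<=` U].
Proof.
move=> hT /hT[V [oV Vx VU nV]]; exists V; split=> //; split=> //.
move=> y Vy; apply: contrapT => nVy; apply: nV.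
have yV : boundary V y by split=> //; rewrite ((interior_id V).1 oV).
by exists (exist _ y (mem_set yV)).
Qed.

Lemma open_mball (x : C) (e : R) : open [set z | mdist z x < e].
Proof.
rewrite openE => z /= zx; apply/nbhs_ballP; exists (e - mdist z x) => /=.
  by rewrite subr_gt0.
move=> y; rewrite ballEmdist /= => zy.
by have := metric_triangle y z x; rewrite (metric_sym y z); lra.
Qed.

Lemma boundary_mball (x : C) (e : R) (z : C) :
  boundary [set z | mdist z x < e] z -> mdist z x = e.
Proof.
rewrite /boundary ((interior_id _).1 (@open_mball x e)).
move=> [zc /= /negP]; rewrite -leNgt => ez; apply/eqP; rewrite eq_le ez andbT.
apply/ler_addgt0Pl => d d0.
have [y [/= yx]] := zc _ (nbhsx_ballx z d d0).
rewrite ballEmdist /= => zy.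
by have := metric_triangle z y x; lra.
Qed.

(* On a sphere the cost of the tail is determined by the first coordinates, so
   the metric topology is that of coordinatewise convergence. *)
Lemma ind_lt1_sphere (x : C) (e : R) (A : set C) : e < r ->
  (forall z, A z -> mdist z x = e) -> ind_lt 1 (set_type A).
Proof.
move=> er Ae; apply: ind_lt1_clopen_base => y U.
move=> [_ [[A0 oA0 <-] /= A0y A0U]].
have /nbhs_ballP[h /= h0 hA0] : nbhs (set_val y) A0 by exact: open_nbhs_nbhs.
have ye : mdist (set_val y) x = e by apply: Ae; exact: set_valP.
have [|c cy] := @expansion_exists (set_val y - x).
  by rewrite mdist_sub0 ye.
(* The norm is the supremum of the partial costs, so some partial cost is within [h / 2] of [e]. *)
have [k hk] : exists k, e < cost c k + h / 2.
  apply: contrapT => /forallNP nk.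
  have : mdist (set_val y - x) 0 <= e - h / 2.
    apply: (norm_le_cost (k := 0) cy) => l _.
    by have /negP := nk l; rewrite -leNgt; lra.
  by rewrite mdist_sub0 ye; lra.
exists (set_val @^-1` agreeing x k c); split.
- split; first by exists (agreeing x k c) => //; exact: open_agreeing.
  have -> : set_val @^-1` agreeing x k c =
      ~` (set_val @^-1` differing x k c) :> set (set_type A).
    apply/seteqP; split=> z; first exact: agreeing_disjoint.
    move=> nz; apply: contrapT => /agreeing_or_differing; apply: contra_not nz.
    by apply; rewrite Ae//; exact: set_valP.
  apply: open_closedC; exists (differing x k c) => //.
  exact: open_differing.
- by split; [rewrite ye|exists c].
- move=> z [zr [d dz cd]]; apply: A0U; apply: hA0; rewrite ballEmdist /=.
  have ze : mdist (set_val z) x = e by apply: Ae; exact: set_valP.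
  have ck : cost d k = cost c k by apply: eq_cost => j /ltnW /cd.
  (* Both tails past [k] cost at most [e - cost c k], which is below [h / 2]. *)
  rewrite -(mdist_subr2 x) (@le_lt_trans _ _ (2 * (e - cost c k)))//; last by lra.
  apply: (mdist_le_cost (k := k) cy dz) => l kl.
  have h1 := costB_tail p_gt0 (fun j jk => cd j (ltnW jk)) kl.
  have := cost_le_norm l cy; have := cost_le_norm l dz.
  rewrite !mdist_sub0 ye ze; move: h1; rewrite ck; lra.
Qed.

Lemma completion_ind_lt2 : ind_lt 2 C.
Proof.
move=> x U /nbhs_ballP[h /= h0 hU].
pose e := Num.min h r / 2.
have m0 : 0 < Num.min h r by rewrite lt_min h0.
have e0 : 0 < e by rewrite divr_gt0.
have mh : Num.min h r <= h by rewrite ge_min lexx.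
have mr : Num.min h r <= r by rewrite ge_min lexx orbT.
have eh : e < h by rewrite /e; lra.
have er : e < r by rewrite /e; lra.
exists [set z | mdist z x < e]; split.
- exact: open_mball.
- by rewrite /= mdistxx.
- move=> z /= zx; apply: hU; rewrite ballEmdist /= metric_sym.
  exact: lt_trans eh.
- by apply: (@ind_lt1_sphere x e) => // z; exact: boundary_mball.
Qed.

(** * Lower bound on the dimension by a greedy construction *)

Lemma last_exit (V : set C) (e : R) c j : e + p j < r ->
    (forall z, V z -> mdist z 0 < e) ->
    V ('i (comb c j)) -> cost c j < e ->
  exists t : nat, [/\ V ('i (comb c j + g j *~ t)), cost c j + t%:R * p j < e &
    ~ V ('i (comb c j + g j *~ t.+1))].
Proof.
move=> ej Ve V0 c0; apply: contrapT => nt.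
(* Without an exit all multiples would stay in [V]; there the norm equals the cost, so the cost
   would stay below [e] forever. *)
have h (t : nat) : V ('i (comb c j + g j *~ t)) /\ cost c j + t%:R * p j < e.
  elim: t => [|t [Vt ct]]; first by rewrite mulr0z addr0 mul0r addr0.
  have Vt1 : V ('i (comb c j + g j *~ t.+1)).
    by apply: contrapT => nV; apply: nt; exists t.
  split=> //; pose d i := if i == j then t.+1%:Z else c i.
  have dc i : (i < j)%N -> d i = c i by rewrite /d => ij; rewrite ltn_eqF.
  have dE : comb d j.+1 = comb c j + g j *~ t.+1.
    by rewrite combS (eq_comb _ dc) /d eqxx.
  have dk : cost d j.+1 = cost c j + t.+1%:R * p j.
    by rewrite costS (eq_cost _ dc) /d eqxx ger0_norm.
  (* The bound [e + p j < r] leaves room for one more generator in the range where [N_comb] is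
     exact. *)
  have dr : cost d j.+1 < 2 * r.
    by rewrite dk -natr1 mulrDl mul1r; move: ct ej (p_gt0 j) r_gt0; lra.
  have := Ve _ Vt1; rewrite -to_completion0 mdist_to_completion subr0 -dE.
  by rewrite N_comb// dk.
have e0 : 0 < e := le_lt_trans (cost_ge0 p_gt0 c j) c0.
have [t ht] : exists t : nat, e < t%:R * p j.
  exists (Num.bound (e / p j)); rewrite -ltr_pdivrMr//.
  by rewrite archi_boundP// divr_ge0// ltW.
by have [_] := h t; have := cost_ge0 p_gt0 c j; lra.
Qed.

Definition single j (a : int) : nat -> int := fun i => if i == j then a else 0.

Lemma single_supp j a i : (j.+1 <= i)%N -> single j a i = 0.
Proof. by rewrite /single => /gtn_eqF ->. Qed.

Lemma comb_single j a : comb (single j a) j.+1 = g j *~ a.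
Proof.
rewrite combS {2}/single eqxx (@eq_comb _ g _ (fun=> 0)) => [|i ij].
  by rewrite /comb big1 ?add0r.
by rewrite /single ltn_eqF.
Qed.

Lemma cost_single j a : cost (single j a) j.+1 = `|a|%:~R * p j.
Proof.
rewrite costS {2}/single eqxx (@eq_cost _ p _ (fun=> 0)) => [|i ij].
  by rewrite /cost big1 ?add0r// => i _; rewrite normr0 mul0r.
by rewrite /single ltn_eqF.
Qed.

Lemma N_gen_le j : N (g j) <= p j.
Proof.
have := N_comb_le (single j 1) j.+1.
by rewrite comb_single cost_single mulr1z normr1 mul1r.
Qed.

Lemma expansion_single j a : `|a|%:~R * p j < r ->
  expansion ('i (g j *~ a)) (single j a).
Proof.
move=> ar; split=> [l|e e0].
  rewrite (le_lt_trans (cost_nondec p_gt0 _ (leq_maxl l j.+1)))//.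
  by rewrite (cost_supp _ (@single_supp j a) (leq_maxr l j.+1)) cost_single.
exists j.+1 => l jl.
by rewrite (comb_supp _ (@single_supp j a) jl) comb_single mdistxx.
Qed.

Lemma mdist_comb_tail c k l : (k <= l)%N ->
  mdist ('i (comb c k)) ('i (comb c l)) <= cost c l - cost c k.
Proof.
move=> kl; pose d j := if (j < k)%N then c j else 0.
have d0 j : (k <= j)%N -> d j = 0 by rewrite /d leqNgt => /negbTE ->.
have cd j : (j < k)%N -> c j = d j by rewrite /d => ->.
rewrite metric_sym mdist_to_completion (eq_comb _ cd).
rewrite -(comb_supp _ d0 kl) -combB (le_trans (N_comb_le _ _))//.
by rewrite (le_trans (costB_tail p_gt0 cd kl))// (cost_supp _ d0 kl) subrr addr0.
Qed.

(** Distances between partial sums are at most the increments of the bounded monotone costs, so the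
    partial sums are Cauchy. *)
Lemma comb_cvg c b : (forall k, cost c k <= b) -> exists x : C,
  forall e, 0 < e -> exists k, forall l, (k <= l)%N -> mdist x ('i (comb c l)) <= e.
Proof.
move=> cb.
have cs : has_sup (range (cost c)).
  split; first by exists (cost c 0), 0%N.
  by exists b => _ [k _ <-].
have cc : cauchy ((fun k => comb c k : normed_by N) @ \oo).
  apply/cauchy_seqP => e e0.
  have [_ [k _ <-] hk] := sup_adherent e0 cs.
  have h i j : (i <= j)%N -> (k <= i)%N ->
      mdist (comb c i : normed_by N) (comb c j) < e.
    move=> ij ki; rewrite -to_completion_isometry.
    rewrite (le_lt_trans (mdist_comb_tail _ ij))//.
    have := cost_nondec p_gt0 c ki.
    have : cost c j <= sup (range (cost c)) by apply: ub_le_sup; [case: cs|exists j].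
    lra.
  exists k => i j ki kj; case: (leqP i j) => [ij|/ltnW ij]; first exact: h.
  by rewrite metric_sym; exact: h.
pose u : cauchy_seq (normed_by N) :=
  exist _ (fun k => comb c k : normed_by N) (introT (asboolP _) cc).
by exists (\pi_(C) u)%qT => e e0; exact: (completion_dist_to u).
Qed.

(* Erdős' argument: inside a bounded clopen neighbourhood of 0, add the largest
   possible multiples of the successive generators; the limit is a boundary
   point, since the j-th partial sum is within [p j] of the complement. *)
Lemma completion_not_ind_lt1 : ~ ind_lt 1 C.
Proof.
have r20 : 0 < r / 2 by rewrite divr_gt0.
move=> /ind_lt1_clopen/(_ (nbhsx_ballx (0 : C) (r / 2) r20))[V [[oV cV] V0 Vb]].
have Ve z : V z -> mdist z 0 < r / 2.
  by move=> /Vb; rewrite ballEmdist /= metric_sym.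
have [j0 hj0] := p_lt r20.
(* The invariants are premises of an implication, so that [t] is total on states and can be fed back
   through the recursion [s]. *)
have /choice[t ht] : forall s : nat * (G * R), exists t : nat,
    (exists2 c, s.2.1 = comb c s.1 & s.2.2 = cost c s.1) ->
    V ('i s.2.1) -> s.2.2 < r / 2 ->
    [/\ V ('i (s.2.1 + g s.1 *~ t)), s.2.2 + t%:R * p s.1 < r / 2 &
       (j0 <= s.1)%N -> ~ V ('i (s.2.1 + g s.1 *~ t.+1))].
  move=> [j [y a]] /=; have [jj|jj] := leqP j0 j; last first.
    (* Before [j0] the weight may be too large for [last_exit], so nothing is added. *)
    by exists 0%N => _ yV ae; rewrite mulr0z addr0 mul0r addr0; split.
  have [[[c -> ->] [cV' ce]]|] := pselect ((exists2 c, y = comb c j &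
      a = cost c j) /\ V ('i y) /\ a < r / 2); last first.
    by move=> n; exists 0%N => h1 h2 h3; case: n.
  have [|t [h1 h2 h3]] := @last_exit V (r / 2) c j _ Ve cV' ce.
    by have := hj0 _ jj; lra.
  by exists t.
pose s := fix s k := if k is j.+1 then
  let u := t (j, s j) in ((s j).1 + g j *~ u, (s j).2 + u%:R * p j) else (0, 0).
pose c j := (t (j, s j))%:Z.
have sE j : s j = (comb c j, cost c j).
  elim: j => [|j ih]; first by rewrite /comb /cost !big_ord0.
  by rewrite combS costS /= ih /c ih ger0_norm.
have inv j : V ('i (comb c j)) /\ cost c j < r / 2.
  elim: j => [|j [h1 h2]]; first by rewrite /comb /cost !big_ord0.
  have [|||] := ht (j, s j); rewrite sE /=; first by exists c.
    by [].
    by [].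
  move=> h3 h4 _; rewrite combS costS; move: h3 h4; rewrite -sE -/(c j).
  by rewrite ger0_norm.
have exit j : (j0 <= j)%N -> ~ V ('i (comb c j.+1 + g j)).
  move=> jj; have [h1 h2] := inv j.
  have [|||] := ht (j, s j); rewrite sE /=; first by exists c.
    by [].
    by [].
  move=> _ _ /(_ jj); rewrite -sE combS -addrA -/(c j).
  by rewrite -[t _]/(absz (c j)) -addn1 PoszD mulrzDr.
have [x hx] := @comb_cvg c (r / 2) (fun j => ltW (inv j).2).
have Vx : V x.
  apply: cV => B /nbhs_ballP[e /= e0 eB].
  have e20 : 0 < e / 2 by rewrite divr_gt0.
  have [k /(_ _ (leqnn k)) hk] := hx _ e20.
  exists ('i (comb c k)); split; first by have [] := inv k.
  by apply: eB; rewrite ballEmdist /=; lra.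
have /nbhs_ballP[e /= e0 eV] : nbhs x V by exact: open_nbhs_nbhs.
(* The limit is within [e / 3] of a late partial sum, and one more generator, of norm below [e / 3],
   leaves [V]: this contradicts openness. *)
have e30 : 0 < e / 3 by rewrite divr_gt0.
have [k1 h1] := hx _ e30; have [k2 h2] := p_lt e30.
pose j := maxn j0 (maxn k1 k2).
have j0j : (j0 <= j)%N by rewrite leq_max leqnn.
have k1j : (k1 <= j.+1)%N by rewrite leqW// !leq_max leqnn orbT.
have k2j : (k2 <= j)%N by rewrite !leq_max leqnn !orbT.
apply: (exit j j0j); apply: eV; rewrite ballEmdist /=.
rewrite (le_lt_trans (metric_triangle _ ('i (comb c j.+1)) _))//.
rewrite mdist_to_completion opprD addNKr gnormN.
by have := h1 _ k1j; have := h2 _ k2j; have := N_gen_le j; lra.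
Qed.

(** * Failure of local compactness *)

Lemma completion_not_locally_compact : ~ locally_compact [set: C].
Proof.
move=> /(_ 0 I)[K]; rewrite withinET => /nbhs_ballP[b /= b0 bK] [cK _].
pose e := Num.min b r / 2.
have m0 : 0 < Num.min b r by rewrite lt_min b0.
have mb : Num.min b r <= b by rewrite ge_min lexx.
have mr : Num.min b r <= r by rewrite ge_min lexx orbT.
have e0 : 0 < e by rewrite divr_gt0.
have eb : e < b by rewrite /e; lra.
have er : e < r by rewrite /e; lra.
have e20 : 0 < e / 2 by rewrite divr_gt0.
have e40 : 0 < e / 4 by rewrite divr_gt0.
have [j0 hj0] := p_lt e20.
(* The least multiple of weight at least [e / 2] is taken; since [p j < e / 2], it weighs less than
   [e]. *)
have /choice[t ht] : forall n, exists t : nat,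
    e / 2 <= t%:R * p (j0 + n)%N /\ t%:R * p (j0 + n)%N < e.
  move=> n; set j := (j0 + n)%N.
  have ex : exists t : nat, e / 2 <= t%:R * p j.
    exists (Num.bound (e / 2 / p j)); rewrite -ler_pdivrMr//.
    by rewrite ltW// archi_boundP// divr_ge0// ltW.
  case: (ex_minnP ex) => -[|t] h1 h2; first by move: h1; rewrite mul0r; lra.
  exists t.+1; split=> //.
  have : t%:R * p j < e / 2 by rewrite ltNge; apply/negP => /h2; rewrite ltnn.
  by rewrite -[t.+1%:R]natr1 mulrDl mul1r; have := hj0 j (leq_addr _ _); lra.
pose X n : C := 'i (g (j0 + n)%N *~ t n).
have Xe n : expansion (X n) (single (j0 + n)%N (t n)).
  apply: expansion_single; rewrite ger0_norm// (lt_trans _ er)//; exact: (ht n).2.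
have XK n : K (X n).
  apply: bK; rewrite ballEmdist /= metric_sym (le_lt_trans _ eb)//.
  apply: (norm_le_cost (k := (j0 + n).+1) (Xe n)) => l jl.
  rewrite (cost_supp _ (@single_supp _ _) jl) cost_single ger0_norm//.
  exact: ltW (ht n).2.
(* At coordinate [j0 + m] one expansion has [t m] and the other 0; this coordinate alone costs at
   least [e / 2]. *)
have X_sep m n : (m < n)%N -> e / 2 <= mdist (X m) (X n).
  move=> mn; rewrite (le_trans _ (cost_le_mdist (j0 + m).+1 (Xe m) (Xe n)))//.
  rewrite (le_trans _ (cost_coord p_gt0 _ (ltnSn (j0 + m))))//=.
  rewrite /single eqxx ltn_eqF ?ltn_add2l// subr0 ger0_norm//.
  exact: (ht m).1.
have XKoo : (X @ \oo) K by exists 0%N => // k _; exact: XK.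
have [y [_ cy]] := cK (X @ \oo) _ XKoo.
(* Two distinct terms within [e / 4] of the cluster point will contradict the separation. *)
have near_y n : exists2 m, (n <= m)%N & mdist y (X m) < e / 4.
  have Xn : (X @ \oo) [set X m | m in [set m | (n <= m)%N]].
    by exists n => // k nk; exists k.
  have [z [[m nm <-]]] := cy _ _ Xn (nbhsx_ballx y (e / 4) e40).
  by rewrite ballEmdist; exists m.
have [m _ hm] := near_y 0%N; have [n mn hn] := near_y m.+1.
have := X_sep _ _ mn; have := metric_triangle (X m) y (X n).
by rewrite (metric_sym (X m) y); lra.
Qed.

End free_up_to_small_cost.

(** * Integer combinations of vectors with rapidly growing Euclidean norms *)

Section euclidean.
Context {R : realType} {n : nat}.
Implicit Types x y : 'rV[R]_n.

Definition dot x y : R := \sum_i x ord0 i * y ord0 i.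

Lemma dotDl x x' y : dot (x + x') y = dot x y + dot x' y.
Proof. by rewrite -big_split; apply: eq_bigr => i _; rewrite mxE mulrDl. Qed.

Lemma dotMzl x y (a : int) : dot (x *~ a) y = a%:~R * dot x y.
Proof.
rewrite mulr_sumr; apply: eq_bigr => i _.
by rewrite -scaler_int mxE mulrA.
Qed.

Lemma dot0l y : dot 0 y = 0.
Proof. by rewrite /dot big1// => i _; rewrite mxE mul0r. Qed.

Lemma dotxx x : dot x x = euclidean_norm x ^+ 2.
Proof.
rewrite sqr_sqrtr; last by apply: sumr_ge0 => i _; exact: sqr_ge0.
by apply: eq_bigr => i _; rewrite expr2.
Qed.

(** Cauchy-Schwarz: nonnegative squares of [b * |x_i| - a * |y_i|] are summed over the coordinates,
    and [2 * (a * b)] is cancelled. *)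
Lemma dot_le x y : x != 0 -> y != 0 ->
  `|dot x y| <= euclidean_norm x * euclidean_norm y.
Proof.
move=> /euclidean_norm_gt0 x0 /euclidean_norm_gt0 y0.
set a := euclidean_norm x in x0 *; set b := euclidean_norm y in y0 *.
have ab0 : 0 < 2 * (a * b) by rewrite !mulr_gt0.
rewrite -(ler_pM2l ab0) (le_trans (ler_wpM2l (ltW ab0) (ler_norm_sum _ _ _)))//.
have -> : 2 * (a * b) * (a * b) = b ^+ 2 * dot x x + a ^+ 2 * dot y y.
  by rewrite !dotxx -/a -/b; ring.
rewrite !mulr_sumr -big_split; apply: ler_sum => i _ /=.
have := sqr_ge0 (b * `|x ord0 i| - a * `|y ord0 i|).
rewrite sqrrB !exprMn !real_normK ?num_real// normrM; lra.
Qed.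

Variable v : nat -> 'rV[R]_n.
Hypothesis v_neq0 : forall j, v j != 0.
Local Notation a := (fun j => euclidean_norm (v j)).

(** Each term contributes at most an increment of the norms, and the increments telescope. *)
Lemma dot_comb_le (c : nat -> int) k y : y != 0 ->
  (forall j, (j < k)%N -> `|c j|%:~R * a j <= a j.+1 - a j) ->
  `|dot (comb v c k) y| <= (a k - a 0%N) * euclidean_norm y.
Proof.
move=> y0; elim: k => [_|k ih hc].
  by rewrite /comb big_ord0 dot0l normr0 subrr mul0r.
have y_gt0 := euclidean_norm_gt0 y0.
rewrite combS dotDl dotMzl (le_trans (ler_normD _ _))//.
have h1 := ih (fun j jk => hc j (ltnW jk)).
have h2 : `|(c k)%:~R * dot (v k) y| <= (a k.+1 - a k) * euclidean_norm y.
  have c0 : 0 <= `|c k|%:~R :> R by rewrite ler0z.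
  rewrite normrM -intr_norm (le_trans (ler_wpM2l c0 (dot_le (v_neq0 k) y0)))//.
  by rewrite mulrA ler_pM2r//; exact: hc.
by apply: (le_trans (lerD h1 h2)); rewrite -mulrDl ler_pM2r//; lra.
Qed.

(* Telescoping makes the top term longer than the sum of all the others. *)
Lemma comb_eq0 (c : nat -> int) k :
  (forall j, (j < k)%N -> `|c j|%:~R * a j <= a j.+1 - a j) ->
  comb v c k = 0 -> forall j, (j < k)%N -> c j = 0.
Proof.
elim: k => [//|k ih] hc v0.
have h1 := dot_comb_le (v_neq0 k) (fun j jk => hc j (ltnW jk)).
have ak0 := euclidean_norm_gt0 (v_neq0 k).
have a00 := euclidean_norm_gt0 (v_neq0 0).
have ck : c k = 0.
  have h2 : dot (comb v c k) (v k) = - ((c k)%:~R * a k ^+ 2).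
    apply/eqP; rewrite -addr_eq0 -dotxx -dotMzl -dotDl -combS v0.
    by rewrite dot0l.
  move: h1; rewrite h2 normrN normrM -intr_norm.
  rewrite (ger0_norm (sqr_ge0 _)) expr2 mulrA ler_pM2r// => h1.
  (* With constant weight [a k], the bound [|c k| * a k <= a k - a 0 < a k] forces the integer [c k]
     to vanish. *)
  apply: (@cost_small_eq0 R (fun j => a k) (fun=> ak0) _ 0).
  by rewrite (le_lt_trans h1)//; lra.
move=> j; rewrite ltnS leq_eqVlt => /orP[/eqP -> //|]; apply: ih.
  by move=> i ik; exact: hc (ltnW ik).
by move: v0; rewrite combS ck mulr0z addr0.
Qed.

End euclidean.

(** * The group generated by an extended norming pair *)

Section enp_generators.
Context {R : realType} {n m : nat} (s : snp R n) (q : nat -> 'rV[R]_m).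
Local Notation w := (enp_vec s q).
Local Notation v := (snp_vec s).
Local Notation p := (snp_wt s).
Local Notation a := (fun j => euclidean_norm (v j)).

Lemma generated_gen j : w j \in generated_pred w.
Proof. by apply/generated_predP => H [_]; apply; exists j. Qed.

Definition enp_gen j : generated_group w := GeneratedGroup (generated_gen j).

Lemma val_comb c k : val (comb enp_gen c k) = comb w c k.
Proof. by rewrite raddf_sum; apply: eq_bigr => j _; rewrite raddfMz. Qed.

Lemma lsubmx_comb c k : lsubmx (comb w c k) = comb v c k.
Proof.
by rewrite raddf_sum; apply: eq_bigr => j _; rewrite raddfMz /= row_mxKl.
Qed.

Lemma enp_norm_comb_le c k : enp_norm s q (comb enp_gen c k) <= cost p c k.
Proof.
apply: sigma_le; first exact: snp_wt_gt0.
by exists k, c; rewrite val_comb.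
Qed.

Lemma enp_norm_lt_comb (x : generated_group w) e : enp_norm s q x < e ->
  exists c k, x = comb enp_gen c k /\ cost p c k < e.
Proof.
move=> xe.
have hx := combination_costs_has_inf (snp_wt_gt0 s) (generated_predP _ _ (valP x)).
have [_ [k [c [xE ->]]] ce] := inf_lt hx.1 xe.
by exists c, k; split=> //; apply: val_inj; rewrite val_comb.
Qed.

(** Cost below [p J] kills the coefficients before [J]; cost below 1 bounds the later ones through
    the growth condition. Then [comb_eq0] applies to the projection to the first [n] coordinates. *)
Lemma enp_comb_free J :
  (forall j, (J <= j)%N -> 1 <= p j * (Num.floor (a j.+1 / a j - 1))%:~R) ->
  forall c k, cost p c k < Num.min 1 (p J) -> comb enp_gen c k = 0 ->
  forall j, (j < k)%N -> c j = 0.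
Proof.
move=> hJ c k; rewrite lt_min => /andP[c1 cJ] c0.
have p0 := snp_wt_gt0 s.
apply: (comb_eq0 (snp_vec_neq0 s)); last first.
  by rewrite -lsubmx_comb -val_comb c0 raddf0.
move=> j jk; have aj := euclidean_norm_gt0 (snp_vec_neq0 s j).
have cj := cost_coord p0 c jk.
have [Jj|/ltnW jJ] := leqP J j; last first.
  rewrite (_ : c j = 0) ?normr0 ?mul0r ?subr_ge0; first exact: snp_vec_nondec.
  apply: (cost_small_eq0 p0 (k := j)).
  by rewrite (le_lt_trans cj)// (lt_le_trans cJ)// snp_wt_noninc.
(* Multiplied by [p j], the left side is below 1 while the floor is at least 1. *)
have : `|c j|%:~R <= a j.+1 / a j - 1.
  rewrite (le_trans _ (floor_le _))// ltW// -(ltr_pM2r (p0 j)).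
  by rewrite (le_lt_trans cj)// (lt_le_trans c1)// mulrC hJ.
by rewrite -(ler_pM2r aj) mulrBl divfK ?gt_eqF// mul1r.
Qed.

End enp_generators.

Unset Implicit Arguments.

Theorem theorem5p4 (R : realType) (n m : nat)
    (n_ge1 : (1 <= n)%N) (m_ge1 : (1 <= m)%N)
    (s : snp R n)
    (s_growth : \forall j \near \oo,
       1 <= snp_wt s j *
            (Num.floor (euclidean_norm (snp_vec s j.+1)
                          / euclidean_norm (snp_vec s j) - 1))%:~R)
    (q : nat -> 'rV[R]_m) :
  [/\ has_dimension (completion (enp_group s q)) 1,
      locally_totally_disconnected (completion (enp_group s q)) &
      ~ locally_compact [set: completion (enp_group s q)]].
Proof.
have [J _ hJ] := s_growth.
have p0 := snp_wt_gt0 s.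
(* The quarter makes [4 * r] equal to the cost bound of [enp_comb_free]. *)
pose r := Num.min 1 (snp_wt s J) / 4.
have r0 : 0 < r by rewrite divr_gt0// lt_min ltr01 p0.
have free c k : cost (snp_wt s) c k < 4 * r -> comb (enp_gen s q) c k = 0 ->
    forall j, (j < k)%N -> c j = 0.
  move=> ck; apply: (enp_comb_free hJ).
  by move: ck; rewrite /r mulrC divfK// pnatr_eq0.
have pni := @snp_wt_noninc _ _ s; have pc := @snp_wt_cvg _ _ s.
have le := @enp_norm_comb_le _ _ _ s q; have lt := @enp_norm_lt_comb _ _ _ s q.
split.
- split; first exact: (completion_ind_lt2 p0 pni pc le lt r0 free).
  exact: (completion_not_ind_lt1 p0 pc le lt r0 free).
- exact: (completion_locally_totally_disconnected p0 pni pc le lt r0 free).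
- exact: (completion_not_locally_compact p0 pc le lt r0 free).
Qed.
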